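(* Let $m$ be a positive integer such that $m^2+1$ is square-free. Then $h(m^2+1)=1$ if and only if either $m=1$, or $m=2p$ for some prime $p$ such that $p^2-t(t+1)$ is a prime number for every integer $t$ with $1\le t\le p-1$.
   Context: For a square-free integer $d>1$, $h(d)$ denotes the class number of the real quadratic field $\mathbb{Q}(\sqrt d)$.
   Formalization: The case m = 2 is added to the right-hand side (''m = 1, or m = 2, or m = 2p ...''), because h(5) = 1 although 2 is not twice a prime, so the statement as written fails at m = 2. *)

(* Defs.v *)
From mathcomp Require Import all_boot all_order all_algebra all_field.
From mathcomp Require Import finmap.
From mathcomp Require Import boolp classical_sets functions cardinality.

Set Implicit Arguments.
Unset Strict Implicit.
Unset Printing Implicit Defensive.

Import Order.TTheory GRing.Theory Num.Theory.
Local Open Scope classical_set_scope.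
Local Open Scope ring_scope.

Definition square_free (n : nat) : Prop :=
  forall k : nat, (k ^ 2 %| n)%N -> k = 1%N.

Definition quad_field (d : nat) : set algC :=
  [set x | exists a b : rat, x = ratr a + ratr b * sqrtC d%:R].

Definition quad_integers (d : nat) : set algC :=
  [set x | quad_field d x /\ x \in Aint].

Record fractional_ideal (d : nat) (I : set algC) : Prop := FractionalIdeal {
  fracI_sub : I `<=` quad_field d;
  fracI_neq0 : exists2 x, I x & x != 0;
  fracI_add : forall x y, I x -> I y -> I (x + y);
  fracI_mul : forall a x, quad_integers d a -> I x -> I (a * x);
  fracI_denom : exists c, [/\ quad_integers d c, c != 0 &
                  forall x, I x -> quad_integers d (c * x)]
}.

(* The coset of I modulo principal fractional ideals: since (x) I = x I, it
   consists of the multiples x I with x a nonzero element of the field. *)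
Definition ideal_class (d : nat) (I : set algC) : set (set algC) :=
  [set J | exists x, [/\ quad_field d x, x != 0 & J = [set x * y | y in I]]].

Definition class_group (d : nat) : set (set (set algC)) :=
  [set ideal_class d I | I in fractional_ideal d].

(* fset_set is empty on an infinite set, so class_number d = 1 does assert that
   there is exactly one class. *)
Definition class_number (d : nat) : nat := #|` fset_set (class_group d)|.

(* Main.v *)
(* Write d = m ^ 2 + 1. The ring of integers is Z + Z w with w ^ 2 = e w + c:
   w = sqrt d, (e, c) = (0, d) for m odd, and w = (1 + sqrt d) / 2,
   (e, c) = (1, n ^ 2) for m = 2 n. Since m + sqrt d is a unit, a value
   u ^ 2 - d v ^ 2 that is smaller than 2 m in absolute value is, up to sign, a
   square. So, if h = 1, no prime below n divides a norm N(t + w) =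
   t ^ 2 + t - n ^ 2 (for m odd: 2 divides N(w) = - d, whence m = 1), which
   makes n and all the n ^ 2 - t (t + 1) >= n prime.
   Conversely, the ring is principal by the Dedekind-Hasse criterion: a
   fraction outside the ring reduces to (b + w) / q with q prime and
   q %| N(b + w), where b may be changed modulo q, and it suffices to get
   |N(b + w)| < q ^ 2. Any 0 <= b < q will do if q > n; if q <= n the primality
   hypotheses force q = n ^ 2 - b (b + 1), or b = 0 and q = n, in which case
   N(- n + w) = - n. *)

Require Import Defs.
From mathcomp Require Import all_boot all_order all_algebra all_field.
From mathcomp Require Import finmap boolp classical_sets functions cardinality.
From mathcomp Require Import ring lra zify.
Import Order.TTheory GRing.Theory Num.Theory.

Lemma prime_not_square (k : nat) : ~ prime (k ^ 2).
Proof.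
move=> /[dup] /prime_gt1 + /primeP[_ /(_ k)]; rewrite -mulnn dvdn_mulr // => + /(_ isT).
case: k => [|[|k]] // _ /orP[] // /eqP.
by rewrite -[X in X = _]muln1 => /eqP; rewrite eqn_pmul2l.
Qed.

(** * Small values of the form u ^ 2 - d v ^ 2 *)

Section SmallNorms.
Local Open Scope ring_scope.

(** Descent on [|v|]: multiplication by the unit m - sqrt d, of norm - 1, only changes the sign of
    the value, and it makes a nonzero v strictly smaller as long as the value stays below 2 m. At v
    = 0 the value is u ^ 2. *)
Lemma small_norm_is_square (m : nat) (u v : int) :
  `|u ^+ 2 - (m%:Z ^+ 2 + 1) * v ^+ 2| < (2 * m)%N%:Z ->
  exists k : nat, `|u ^+ 2 - (m%:Z ^+ 2 + 1) * v ^+ 2| = (k ^ 2)%N%:Z.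
Proof.
have [k] := ubnP `|v|%N; elim: k u v => // k IHk u v lt_v_k small.
have [-> | v_neq0] := eqVneq v 0.
  by exists `|u|%N; rewrite expr0n /= mulr0 subr0 -abszX abszE.
wlog [u_ge0 v_gt0]: u v lt_v_k small v_neq0 / 0 <= u /\ 0 < v.
  move=> /(_ `|u| `|v|); rewrite !real_normK ?num_real //; apply; lia.
(* u' + v' sqrt d = (m - sqrt d) (u + v sqrt d) *)
pose v' := m%:Z * v - u; pose u' := m%:Z * u - (m%:Z ^+ 2 + 1) * v.
have flip : u' ^+ 2 - (m%:Z ^+ 2 + 1) * v' ^+ 2 =
    - (u ^+ 2 - (m%:Z ^+ 2 + 1) * v ^+ 2) by rewrite /u' /v'; ring.
rewrite -normrN -flip; apply: IHk; last by rewrite flip normrN.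
suff : `|v'| < v by lia.
rewrite /v' {u' v' flip lt_v_k v_neq0}.
case: (ltP `|m%:Z * v - u| v) => // far; exfalso.
(* If v did not shrink, u would lie outside the open interval from (m - 1) v to (m + 1) v. Since (m
   + 1) ^ 2 - d = 2 m and (m - 1) ^ 2 - d = - 2 m, the value would be at least 2 m v ^ 2 in size. *)
have [big | big] : u >= (m%:Z + 1) * v \/ u <= (m%:Z - 1) * v by lia.
  have : u ^+ 2 >= ((m%:Z + 1) * v) ^+ 2 by nia.
  nia.
have : u ^+ 2 <= ((m%:Z - 1) * v) ^+ 2 by nia.
nia.
Qed.

End SmallNorms.

(** * Arithmetic in Q + Q w and Z + Z w, for either shape of w *)

Section QuadraticRing.
Local Open Scope ring_scope.
Variables (w : algC) (e c : int).
Hypothesis w_sqr : w ^+ 2 = e%:~R * w + c%:~R.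
Hypothesis w_irr : forall a b : rat, ratr a + ratr b * w = 0 -> b = 0.

Definition qel (a b : rat) : algC := ratr a + ratr b * w.
(** The conjugate of w is e - w, and this is the product of a + b w with its conjugate. *)
Definition qnorm (a b : rat) : rat := a ^+ 2 + e%:~R * a * b - c%:~R * b ^+ 2.
Definition zel (x y : int) : algC := qel x%:~R y%:~R.
Definition znorm (x y : int) : int := x ^+ 2 + e * x * y - c * y ^+ 2.

Lemma qelB a b a' b' : qel a b - qel a' b' = qel (a - a') (b - b').
Proof. by rewrite /qel !rmorphB /=; ring. Qed.

Lemma qelD a b a' b' : qel a b + qel a' b' = qel (a + a') (b + b').
Proof. by rewrite /qel !rmorphD /=; ring. Qed.

Lemma qelM a b a' b' : qel a b * qel a' b' =
  qel (a * a' + c%:~R * b * b') (a * b' + b * a' + e%:~R * b * b').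
Proof.
rewrite /qel !(rmorphD, rmorphM) /= !ratr_int.
have -> : forall A B A' B' : algC, (A + B * w) * (A' + B' * w) =
   A * A' + (A * B' + B * A') * w + B * B' * w ^+ 2 by move=> *; ring.
by rewrite w_sqr; ring.
Qed.

Lemma qel_eq0 a b : qel a b = 0 -> a = 0 /\ b = 0.
Proof.
move=> ab0; have b0 := w_irr _ _ ab0; split=> //.
by move: ab0; rewrite /qel b0 rmorph0 mul0r addr0 => /eqP; rewrite fmorph_eq0 => /eqP.
Qed.

Lemma qel_inj a b a' b' : qel a b = qel a' b' -> a = a' /\ b = b'.
Proof.
move=> E; have [] : a - a' = 0 /\ b - b' = 0.
  by apply: qel_eq0; rewrite -qelB E subrr.
by move=> /subr0_eq -> /subr0_eq ->.
Qed.

Lemma qnormM a b a' b' :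
  qnorm (a * a' + c%:~R * b * b') (a * b' + b * a' + e%:~R * b * b') =
  qnorm a b * qnorm a' b'.
Proof. by rewrite /qnorm; ring. Qed.

Lemma qel_conj a b : qel a b * qel (a + e%:~R * b) (- b) = ratr (qnorm a b).
Proof.
rewrite qelM.
have -> : a * - b + b * (a + e%:~R * b) + e%:~R * b * - b = 0 by ring.
by rewrite /qel rmorph0 mul0r addr0; congr ratr; rewrite /qnorm; ring.
Qed.

Lemma qnorm_eq0 a b : qnorm a b = 0 -> a = 0 /\ b = 0.
Proof.
move=> ab0; have /eqP := qel_conj a b; rewrite ab0 rmorph0 mulf_eq0.
move=> /orP[] /eqP /qel_eq0 [] //.
by move=> + /eqP; rewrite oppr_eq0 => + /eqP b0; rewrite b0 mulr0 addr0.
Qed.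

Lemma qel_div a b a' b' : qel a' b' != 0 ->
  exists a'' b'', qel a b / qel a' b' = qel a'' b''.
Proof.
move=> nz; have nmz : qnorm a' b' != 0.
  by apply: contra nz => /eqP /qnorm_eq0 [-> ->]; rewrite /qel !rmorph0 mul0r addr0.
(* The inverse is the conjugate divided by the norm. *)
suff -> : qel a b / qel a' b' =
   qel a b * (qel (a' + e%:~R * b') (- b') * qel (qnorm a' b')^-1 0).
  by rewrite !qelM; do 2 eexists.
congr (_ * _); apply: (mulfI nz).
rewrite mulfV // mulrA qel_conj /qel rmorph0 mul0r addr0 fmorphV mulfV //.
by rewrite fmorph_eq0.
Qed.

Lemma qnorm_int x y : qnorm x%:~R y%:~R = (znorm x y)%:~R.
Proof. by rewrite /qnorm /znorm; ring. Qed.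

Lemma zelB x y x' y' : zel x y - zel x' y' = zel (x - x') (y - y').
Proof. by rewrite /zel qelB !rmorphB. Qed.

Lemma zelM x y x' y' : zel x y * zel x' y' =
  zel (x * x' + c * y * y') (x * y' + y * x' + e * y * y').
Proof. by rewrite /zel qelM; congr qel; ring. Qed.

Lemma zel_inj x y x' y' : zel x y = zel x' y' -> x = x' /\ y = y'.
Proof. by move=> /qel_inj[/intr_inj -> /intr_inj ->]. Qed.

Lemma znormM x y x' y' :
  znorm (x * x' + c * y * y') (x * y' + y * x' + e * y * y') =
  znorm x y * znorm x' y'.
Proof. by rewrite /znorm; ring. Qed.

(** * Class number one and principal ideals *)

Variable d : nat.
Hypothesis fieldP : forall z, quad_field d z <-> exists a b, z = qel a b.
Hypothesis integersP : forall z, quad_integers d z <-> exists x y, z = zel x y.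

Lemma quad_fieldM z z' : quad_field d z -> quad_field d z' -> quad_field d (z * z').
Proof.
move=> /fieldP[a [b ->]] /fieldP[a' [b' ->]]; apply/fieldP.
by rewrite qelM; do 2 eexists.
Qed.

Lemma quad_field_div z z' :
  z' != 0 -> quad_field d z -> quad_field d z' -> quad_field d (z / z').
Proof.
move=> nz /fieldP[a [b ->]] /fieldP[a' [b' def_z']]; apply/fieldP; rewrite def_z' in nz *.
by have [a2 [b2 ->]] := qel_div a b _ _ nz; exists a2, b2.
Qed.

Lemma quad_integers1 : quad_integers d 1.
Proof. by apply/integersP; exists 1, 0; rewrite /zel /qel !ratr_int mul0r addr0. Qed.

Lemma quad_field1 : quad_field d 1.
Proof. exact: (proj1 quad_integers1). Qed.

Lemma quad_integersB z z' :
  quad_integers d z -> quad_integers d z' -> quad_integers d (z - z').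
Proof.
move=> /integersP[x [y ->]] /integersP[x' [y' ->]]; apply/integersP.
by rewrite zelB; do 2 eexists.
Qed.

Lemma quad_integers0 : quad_integers d 0.
Proof. by rewrite -(subrr 1); apply: quad_integersB; apply: quad_integers1. Qed.

Lemma quad_integersN z : quad_integers d z -> quad_integers d (- z).
Proof.
move=> Oz; rewrite -[- z]add0r; apply: quad_integersB => //.
exact: quad_integers0.
Qed.

Lemma quad_integersD z z' :
  quad_integers d z -> quad_integers d z' -> quad_integers d (z + z').
Proof. by move=> Oz /quad_integersN Oz'; rewrite -[z']opprK; apply: quad_integersB. Qed.

Lemma quad_integersM z z' :
  quad_integers d z -> quad_integers d z' -> quad_integers d (z * z').
Proof.
move=> /integersP[x [y ->]] /integersP[x' [y' ->]]; apply/integersP.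
by rewrite zelM; do 2 eexists.
Qed.

Lemma quad_integers_fractional : fractional_ideal d (quad_integers d).
Proof.
split=> [z []//| | | |]; [| exact: quad_integersD | exact: quad_integersM |].
- by exists 1; [apply: quad_integers1 | apply: oner_neq0].
- exists 1; split; [exact: quad_integers1 | exact: oner_neq0 |].
  by move=> z; rewrite mul1r.
Qed.

Definition principal (I : set algC) := exists x, [/\ quad_field d x, x != 0 &
  I = [set x * y | y in quad_integers d]%classic].

Lemma ideal_class_principal I :
  principal I -> ideal_class d I = ideal_class d (quad_integers d).
Proof.
move=> [x [Kx nzx ->]]; apply/seteqP; split=> J [z [Kz nzz ->]].
  exists (z * x); split; [exact: quad_fieldM | exact: mulf_neq0 |].
  by rewrite image_comp; apply: eq_imagel => y _ /=; rewrite mulrA.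
exists (z / x); split; [exact: quad_field_div | by rewrite mulf_neq0 ?invr_eq0 |].
by rewrite image_comp; apply: eq_imagel => y _ /=; rewrite mulrA divfK.
Qed.

(** Every ideal belongs to its own class. If there is only one class, it is that of the ring, whose
    members are principal; conversely all principal ideals share that class. *)
Lemma class_number1P :
  class_number d = 1%N <-> forall I, fractional_ideal d I -> principal I.
Proof.
split=> [h1 I frI | PID].
  have [A eqA] : exists A, class_group d = [set A]%classic.
    move: h1; rewrite /class_number.
    have [fin | inf] := pselect (finite_set (class_group d)).
      move=> /eqP/cardfs1P[A defA]; exists A.
      by rewrite -(fset_setK fin) defA set_fset1.
    by rewrite /fset_set; case: pselect.
  have inA J : fractional_ideal d J -> ideal_class d J = A.
    by move=> frJ; have : class_group d (ideal_class d J) by [exists J]; rewrite eqA.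
  have : ideal_class d I I.
    exists 1; split; [exact: quad_field1 | exact: oner_neq0 |].
    by rewrite eq_image_id // => y _; rewrite mul1r.
  by rewrite inA // -(inA _ quad_integers_fractional).
rewrite /class_number (_ : class_group d = [set ideal_class d (quad_integers d)]%classic).
  by rewrite fset_set1 cardfs1.
apply/seteqP; split=> [_ [I frI <-] | _ ->] /=.
  exact/ideal_class_principal/PID.
by exists (quad_integers d) => //; apply: quad_integers_fractional.
Qed.

(* q lies below a prime ideal of norm q, namely (q, b + w). *)
Lemma prime_norm_of_principal (q : nat) (b : int) :
  prime q -> (forall I, fractional_ideal d I -> principal I) ->
  (q%:Z %| znorm b 1)%Z -> exists x y, `|znorm x y| = q%:Z.
Proof.
move=> q_pr PID q_dvd.
have q_gt0 := prime_gt0 q_pr; have q_gt1 := prime_gt1 q_pr.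
(* As x + y w = (x - b y) + y (b + w), this is the lattice Z q + Z (b + w). *)
pose I : set algC := [set z | exists x y, z = zel x y /\ (q%:Z %| x - b * y)%Z]%classic.
have frI : fractional_ideal d I.
  split.
  - by move=> z [x [y [-> _]]]; apply/fieldP; do 2 eexists.
  - exists (zel q 0).
      by exists q%:Z, 0; rewrite mulr0 subr0 dvdzz.
    by apply/eqP => /qel_eq0 [] // /eqP; rewrite intr_eq0; lia.
  - move=> _ _ [x [y [-> dvd]]] [x' [y' [-> dvd']]].
    exists (x + x'), (y + y'); rewrite /zel qelD !rmorphD; split=> //.
    have -> : x + x' - b * (y + y') = (x - b * y) + (x' - b * y') by ring.
    exact: rpredD.
  - move=> _ _ /integersP[r [t ->]] [x [y [-> dvd]]].
    rewrite zelM; do 2 eexists; split=> //.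
    (* The divisibility of N(b + w) by q is what makes the lattice stable under multiplication by
       the ring. *)
    rewrite (_ : _ - _ = (x - b * y) * (r - b * t) - y * t * znorm b 1); last first.
      by rewrite /znorm; ring.
    exact: rpredB (dvdz_mulr _ dvd) (dvdz_mull _ q_dvd).
  - exists 1; split; [exact: quad_integers1 | exact: oner_neq0 |].
    by move=> _ [x [y [-> _]]]; apply/integersP; rewrite mul1r; exists x, y.
have [z [_ nz_z defI]] := PID I frI.
have [x [y [def_z dvd_z]]] : I z.
  by rewrite defI; exists 1; [apply: quad_integers1 | rewrite mulr1].
have mem_I u v : (q%:Z %| u - b * v)%Z -> exists r t,
    u = x * r + c * y * t /\ v = x * t + y * r + e * y * t.
  move=> dvd; have : I (zel u v) by exists u, v.
  rewrite defI => -[_ /integersP[r [t ->]]]; rewrite def_z zelM.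
  by move=> /zel_inj[<- <-]; exists r, t.
(* The generator z = x + y w divides both q and b + w; the cofactor of q is r + t w. *)
have [r [t [def_q def_0]]] : exists r t,
    q%:Z = x * r + c * y * t /\ 0 = x * t + y * r + e * y * t.
  by apply: mem_I; rewrite mulr0 subr0 dvdzz.
have [r' [t' [_ def_1]]] : exists r t,
    b = x * r + c * y * t /\ 1 = x * t + y * r + e * y * t.
  by apply: mem_I; rewrite mulr1 subrr dvdz0.
have norm_q : znorm x y * znorm r t = q%:Z ^+ 2.
  by rewrite -znormM -def_q -def_0 /znorm; ring.
(* Modulo q, x is b y, so N(z) is y ^ 2 N(b + w), that is 0. *)
have dvd_N : (q%:Z %| znorm x y)%Z.
  rewrite (_ : znorm x y = (x - b * y) * (x + b * y + e * y) + y ^+ 2 * znorm b 1).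
    exact: rpredD (dvdz_mulr _ dvd_z) (dvdz_mull _ q_dvd).
  by rewrite /znorm; ring.
have /dvdzP[k def_N] := dvd_N; exists x, y.
have k_r : k * znorm r t = q%:Z.
  by apply: (@mulIf _ q%:Z); [lia | rewrite -expr2 -norm_q def_N; ring].
(* From N(z) N(r + t w) = q ^ 2 and q dividing N(z), the norm of the cofactor is 1 or q in absolute
   value; the value q leaves [|N(z)|] = q. *)
have /primeP[_ /(_ `|znorm r t|%N)] := q_pr.
have -> : (`|znorm r t| %| q)%N by rewrite -(absz_nat q) -k_r abszM dvdn_mull.
move=> /(_ isT) /orP[/eqP unit_r | /eqP norm_r]; last first.
  suff : `|k| = 1 by move=> k1; rewrite def_N normrM k1 mul1r.
  have : `|k| * `|znorm r t| = q%:Z by rewrite -normrM k_r.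
  by rewrite -abszE norm_r; nia.
(* Otherwise r + t w is a unit. Multiplying q = z (r + t w) by its conjugate shows that q divides z,
   hence also b + w, whose coefficient at w is 1. *)
exfalso.
have eq_x : q%:Z * (r + e * t) = x * znorm r t.
  have -> : x * znorm r t =
      (x * r + c * y * t) * (r + e * t) - c * t * (x * t + y * r + e * y * t).
    by rewrite /znorm; ring.
  by rewrite -def_q -def_0; ring.
have eq_y : - q%:Z * t = y * znorm r t.
  have -> : y * znorm r t =
      (x * t + y * r + e * y * t) * r - (x * r + c * y * t) * t.
    by rewrite /znorm; ring.
  by rewrite -def_q -def_0; ring.
have dvd_unit u s : u * znorm r t = q%:Z * s -> (q%:Z %| u)%Z.
  move=> E; apply/dvdzP.
  have [n1 | n1] : znorm r t = 1 \/ znorm r t = -1 by lia.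
    by exists s; rewrite mulrC -E n1; ring.
  by exists (- s); rewrite mulNr mulrC -E n1; ring.
have dvd_x : (q%:Z %| x)%Z by apply: (dvd_unit x (r + e * t)).
have dvd_y : (q%:Z %| y)%Z by apply: (dvd_unit y (- t)); rewrite -eq_y; ring.
have : (q%:Z %| x * t' + y * r' + e * y * t')%Z.
  apply: rpredD; first by apply: rpredD; exact: dvdz_mulr.
  exact: dvdz_mulr (dvdz_mull _ dvd_y).
by rewrite -def_1 dvdzE /= dvdn1; lia.
Qed.

(** * The Dedekind-Hasse criterion *)

Definition shrinkable (z : algC) := exists s t a b,
  [/\ quad_integers d s, quad_integers d t, s * z - t = qel a b
    & 0 < `|qnorm a b| < 1].

Lemma quad_integers_zel x y : quad_integers d (zel x y).
Proof. by apply/integersP; exists x, y. Qed.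

(** This allows z to be multiplied by ring elements and translated by them; all the reductions below
    are such moves. *)
Lemma shrinkable_affine s t z : quad_integers d s -> quad_integers d t ->
  shrinkable (s * z - t) -> shrinkable z.
Proof.
move=> Os Ot [s' [t' [a [b [Os' Ot' eq_ab ab_small]]]]].
exists (s' * s), (s' * t + t'), a, b; split=> //; first exact: quad_integersM.
  by apply: quad_integersD => //; apply: quad_integersM.
by rewrite -eq_ab; ring.
Qed.

Section PrimeDenominator.
Variable q : nat.
Hypothesis q_prime : prime q.

Lemma prime_natr_neq0 : q%:R != 0 :> algC.
Proof. by rewrite pnatr_eq0 -lt0n prime_gt0. Qed.

Lemma mulz_inverse_mod (x : int) : ~~ (q%:Z %| x)%Z ->
  exists i k : int, i * x = 1 + k * q%:Z.
Proof.
move=> ndvd; have : coprimez q x by rewrite coprimezE /= prime_coprime.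
move=> /eqP co; have [u [v]] := Bezoutz q x.
by rewrite co => E; exists v, (- u); lia.
Qed.

Lemma zel_natM (x y : int) : zel (x * q%:Z) (y * q%:Z) = zel x y * q%:R.
Proof. by rewrite /zel /qel !ratr_int !rmorphM /= -!pmulrn; ring. Qed.

Lemma shrinkable_translate x y s t :
  shrinkable (zel (x - s * q%:Z) (y - t * q%:Z) / q%:R) -> shrinkable (zel x y / q%:R).
Proof.
move=> sh; apply: (@shrinkable_affine 1 (zel s t)); rewrite ?mul1r //.
- exact: quad_integers1.
- exact: quad_integers_zel.
by move: sh; rewrite -zelB zel_natM // mulrBl mulfK // prime_natr_neq0.
Qed.

Lemma shrinkable_zelM s t x y :
  shrinkable (zel s t * zel x y / q%:R) -> shrinkable (zel x y / q%:R).
Proof.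
move=> sh; apply: (@shrinkable_affine (zel s t) 0); rewrite ?subr0 ?mulrA //.
  exact: quad_integers_zel.
exact: quad_integers0.
Qed.

Lemma shrinkable_norm x y :
  (x != 0) || (y != 0) -> `|znorm x y| < q%:Z ^+ 2 -> shrinkable (zel x y / q%:R).
Proof.
move=> nz small; pose Q : rat := q%:R.
have Q_gt0 : 0 < Q by rewrite ltr0n prime_gt0.
exists 1, 0, (x%:~R / Q), (y%:~R / Q); split.
- exact: quad_integers1.
- exact: quad_integers0.
- rewrite mul1r subr0 /zel /qel !fmorph_div /= ratr_nat; ring.
have -> : qnorm (x%:~R / Q) (y%:~R / Q) = (znorm x y)%:~R / Q ^+ 2.
  by rewrite /qnorm /znorm; field; rewrite lt0r_neq0.
rewrite normrM normfV (ger0_norm (_ : 0 <= Q ^+ 2)) ?exprn_ge0 1?ltW //.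
rewrite divr_gt0 ?exprn_gt0 //=; last first.
  rewrite normr_gt0 -qnorm_int; apply/eqP => /qnorm_eq0 [/eqP + /eqP].
  by rewrite !intr_eq0 => /eqP x0 /eqP y0; rewrite x0 y0 eqxx in nz.
rewrite ltr_pdivrMr ?exprn_gt0 // mul1r -intr_norm /Q.
by rewrite -[q%:R]/((q%:Z)%:~R : rat) -rmorphXn ltr_int.
Qed.

(** Multiplying by an inverse of x modulo q and translating leads to 1 / q, of norm 1 / q ^ 2. *)
Lemma shrinkable_integer x : ~~ (q%:Z %| x)%Z -> shrinkable (zel x 0 / q%:R).
Proof.
move=> /mulz_inverse_mod [i [k inv]].
apply: (@shrinkable_zelM i 0); rewrite zelM.
apply: (@shrinkable_translate _ _ k 0); rewrite inv.
have := prime_gt1 q_prime => q_gt1.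
by apply: shrinkable_norm; [apply/orP; left; lia | rewrite /znorm; nia].
Qed.

Hypothesis small_root : forall b, (q%:Z %| znorm b 1)%Z ->
  exists k, `|znorm (b - k * q%:Z) 1| < q%:Z ^+ 2.

(** An inverse of y modulo q brings the numerator to the form b + w. If q divides N(b + w),
    [small_root] supplies a suitable translate; if not, multiplication by the conjugate gives an
    integer prime to q. *)
Lemma shrinkable_prime_denominator x y :
  ~~ ((q%:Z %| x)%Z && (q%:Z %| y)%Z) -> shrinkable (zel x y / q%:R).
Proof.
have [/dvdzP[k ->] | ] := boolP (q%:Z %| y)%Z.
  rewrite andbT => ndvd; apply: (@shrinkable_translate _ _ 0 k).
  by rewrite mul0r subr0 subrr; apply: shrinkable_integer.
move=> /mulz_inverse_mod [i [k inv]] _.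
apply: (@shrinkable_zelM i 0); rewrite zelM.
apply: (@shrinkable_translate _ _ 0 k).
set b := _ - _; set y1 := _ - _; have -> : y1 = 1 by rewrite /y1; lia.
have [/small_root[j small] | ndvd] := boolP (q%:Z %| znorm b 1)%Z.
  apply: (@shrinkable_translate _ _ j 0); rewrite mul0r subr0.
  by apply: shrinkable_norm; rewrite ?orbT.
(* The multiplier (b + e) - w is the conjugate of b + w. *)
apply: (@shrinkable_zelM (b + e) (- 1)); rewrite zelM.
have -> : (b + e) * b + c * - 1 * 1 = znorm b 1 by rewrite /znorm; ring.
have -> : (b + e) * 1 + - 1 * b + e * - 1 * 1 = 0 by ring.
exact: shrinkable_integer.
Qed.

End PrimeDenominator.

Hypothesis small_root : forall q b, prime q -> (q%:Z %| znorm b 1)%Z ->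
  exists k, `|znorm (b - k * q%:Z) 1| < q%:Z ^+ 2.

(** Let q be a prime factor of k. Either q cancels and induction applies to k / q, or multiplying by
    k / q leaves the prime denominator q. *)
Lemma shrinkable_denominator k x y : (0 < k)%N ->
  ~ quad_integers d (zel x y / k%:R) -> shrinkable (zel x y / k%:R).
Proof.
have [n] := ubnP k; elim: n k x y => // n IHn k x y lt_k k_gt0 notO.
have [k1 | k_neq1] := eqVneq k 1%N.
  by case: notO; rewrite k1 divr1; apply: quad_integers_zel.
have q_pr : prime (pdiv k) by rewrite pdiv_prime //; lia.
have /dvdnP[k' def_k] := pdiv_dvd k; move: (pdiv k) q_pr def_k => q q_pr def_k.
have k'_gt0 : (0 < k')%N by rewrite lt0n; apply/eqP => k'0; rewrite def_k k'0 in k_gt0.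
have q_neq0 := prime_natr_neq0 _ q_pr.
have k'_neq0 : k'%:R != 0 :> algC by rewrite pnatr_eq0 -lt0n.
have [/andP[/dvdzP[x' def_x] /dvdzP[y' def_y]] | ndvd] :=
    boolP ((q%:Z %| x)%Z && (q%:Z %| y)%Z).
  have E : zel x y / k%:R = zel x' y' / k'%:R.
    rewrite def_x def_y zel_natM // def_k natrM; field.
    by rewrite q_neq0 k'_neq0.
  rewrite E; apply: IHn => //; last by rewrite -E.
  have := prime_gt1 q_pr; nia.
have sh := shrinkable_prime_denominator _ q_pr (fun b => small_root q b q_pr) _ _ ndvd.
apply: (@shrinkable_affine (zel k' 0) 0).
- exact: quad_integers_zel.
- exact: quad_integers0.
suff -> : zel k' 0 * (zel x y / k%:R) - 0 = zel x y / q%:R by [].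
rewrite subr0 def_k natrM /zel /qel !ratr_int mul0r addr0 -pmulrn; field.
by rewrite q_neq0 k'_neq0.
Qed.

Lemma shrinkable_field z : quad_field d z -> ~ quad_integers d z -> shrinkable z.
Proof.
move=> /fieldP[a [b ->]].
have -> : qel a b =
    zel (numq a * denq b) (numq b * denq a) / (`|denq a| * `|denq b|)%N%:R.
  have da : (denq a)%:~R != 0 :> algC by rewrite intr_eq0 denq_neq0.
  have db : (denq b)%:~R != 0 :> algC by rewrite intr_eq0 denq_neq0.
  rewrite natrM !natr_absz !gtr0_norm ?denq_gt0 // /zel /qel !ratr_int !rmorphM /=.
  by rewrite /ratr; field; rewrite da db.
by apply: shrinkable_denominator; rewrite muln_gt0 !absz_gt0 !denq_neq0.
Qed.

(* A nonzero element of minimal norm generates the ideal. *)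
Lemma fractional_ideal_principal I : fractional_ideal d I -> principal I.
Proof.
move=> [subK [x0 Ix0 nzx0] addI mulI [s [Os nzs denI]]].
have subI x y : I x -> I y -> I (x - y).
  move=> Ix Iy; apply: addI => //; rewrite -mulN1r; apply: mulI => //.
  exact/quad_integersN/quad_integers1.
(* Norms are taken after multiplication by the common denominator s, so that they are natural
   numbers and a minimum exists. *)
pose P k := `[< exists z x y, [/\ I z, z != 0, s * z = zel x y & k = `|znorm x y|%N] >].
have exP : exists k, P k.
  have /integersP[x [y E]] := denI _ Ix0.
  by exists `|znorm x y|%N; apply/asboolP; exists x0, x, y.
case: (ex_minnP exP) => k /asboolP[z [x [y [Iz nzz eq_z def_k]]]] min_k.
exists z; split=> //; first exact: subK.
apply/seteqP; split=> [u Iu | _ [a Oa <-]]; last by rewrite mulrC; apply: mulI.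
have Kuz : quad_field d (u / z) by apply: quad_field_div => //; apply: subK.
have [Ouz | notO] := pselect (quad_integers d (u / z)).
  by exists (u / z) => //; rewrite mulrC divfK.
have [s' [t [a [b [Os' Ot eq_ab /andP[gt0 lt1]]]]]] := shrinkable_field _ Kuz notO.
(* This v equals (s' (u / z) - t) z, an element of I of smaller nonzero norm than z. *)
exfalso; pose v := s' * u - t * z.
have Iv : I v by apply: subI; apply: mulI.
have def_v : v = qel a b * z by rewrite -eq_ab mulrBl mulrA divfK.
have nz_ab : qel a b != 0.
  apply/eqP => /qel_eq0 [a0 b0]; move: gt0; rewrite a0 b0 /qnorm.
  by rewrite expr0n /= !mulr0 addr0 subrr normr0 ltxx.
have nzv : v != 0 by rewrite def_v mulf_neq0.
have /integersP[x' [y' eq_v]] := denI _ Iv.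
have : (k <= `|znorm x' y'|)%N by apply: min_k; apply/asboolP; exists v, x', y'.
have norm_v : (znorm x' y')%:~R = qnorm a b * (znorm x y)%:~R :> rat.
  rewrite -!qnorm_int -qnormM.
  have : zel x' y' = qel a b * zel x y by rewrite -eq_v -eq_z def_v; ring.
  by rewrite /zel qelM => /qel_inj[<- <-].
have nz_xy : 0 < `|(znorm x y)%:~R| :> rat.
  rewrite normr_gt0 -qnorm_int; apply/eqP => /qnorm_eq0 [x_0 y_0].
  move: (mulf_neq0 nzs nzz); rewrite eq_z /zel x_0 y_0 /qel !rmorph0 mul0r addr0.
  by rewrite eqxx.
rewrite leqNgt => /negP; apply; rewrite def_k.
suff : `|(znorm x' y')%:~R| < `|(znorm x y)%:~R| :> rat.
  by rewrite -!intr_norm ltr_int; lia.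
by rewrite norm_v normrM gtr_pMl.
Qed.
End QuadraticRing.

(** * Algebraic integers of Q(sqrt d) *)

Section QuadraticIntegers.
Local Open Scope ring_scope.

Lemma Aint_quadratic (w : algC) (e c : int) :
  w ^+ 2 = e%:~R * w + c%:~R -> w \in Aint.
Proof.
move=> w_sqr; pose l : {poly algC} := e%:~R *: 'X + (c%:~R)%:P.
have size_l : (size (- l) < size ('X^2 : {poly algC}))%N.
  rewrite size_polyN size_polyXn ltnS (leq_trans (size_polyD _ _)) // geq_max.
  rewrite (leq_trans (size_scale_leq _ _)) ?size_polyX //.
  by rewrite (leq_trans (size_polyC_leq1 _)).
apply: (@root_monic_Aint ('X^2 - l)).
- by rewrite rootE /l !hornerE w_sqr subrr.
- by rewrite monicE lead_coefDl // lead_coefXn.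
- apply/polyOverP => i; rewrite !coefE; apply/intrP.
  exists ((i == 2)%:R - (e * (i == 1)%:R + (if i == 0 then c else 0))).
  by rewrite rmorphB rmorphD rmorphM !rmorph_nat /=; case: ifP.
Qed.

Lemma Aint_ratr_int (a : rat) : ratr a \in Aint -> a \is a Num.int.
Proof. by move=> Aa; rewrite -Cint_rat Cint_rat_Aint // Crat_rat. Qed.

Variable m : nat.
Hypothesis m_gt0 : (0 < m)%N.
Let d := (m ^ 2 + 1)%N.
Hypothesis d_sqf : square_free d.
Let s : algC := sqrtC d%:R.

(** A rational sqrt d would be an algebraic integer, hence an integer, while d lies strictly between
    m ^ 2 and (m + 1) ^ 2. *)
Lemma sqrt_irrational (a b : rat) : ratr a + ratr b * s = 0 -> b = 0.
Proof.
move=> ab0; apply/eqP; apply: contraT => b_neq0.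
have rb_neq0 : ratr b != 0 :> algC by rewrite fmorph_eq0.
have def_s : s = ratr (- a / b).
  rewrite fmorph_div rmorphN /=; apply: (mulfI rb_neq0).
  by rewrite mulrCA divff // mulr1; apply/eqP; rewrite -addr_eq0 addrC ab0.
have : s \in Aint.
  by apply: (@Aint_quadratic _ 0 d); rewrite mul0r add0r sqrtCK.
rewrite def_s => /Aint_ratr_int /intrP[x def_x].
have : (x ^+ 2)%:~R = (d%:Z)%:~R :> algC.
  by rewrite rmorphXn /= -ratr_int -def_x -def_s sqrtCK.
move=> /intr_inj; rewrite -[x ^+ 2]real_normK ?num_real // /d => sqr_x.
have [le_m | gt_m] : `|x| <= m%:Z \/ m%:Z + 1 <= `|x| by lia.
  have : `|x| ^+ 2 <= m%:Z ^+ 2 by nia.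
  by nia.
have : (m%:Z + 1) ^+ 2 <= `|x| ^+ 2 by nia.
by nia.
Qed.

(** A rational polynomial takes conjugate values at conjugate points, so the conjugate of z is a
    root of the minimal polynomial of z, which has integer coefficients. *)
Lemma Aint_conj (a b : rat) :
  ratr a + ratr b * s \in Aint -> ratr a - ratr b * s \in Aint.
Proof.
move=> Az; set z := _ + _ in Az.
have [D ratr_D] : exists D : rat, ratr D = s ^+ 2.
  by exists d%:R; rewrite ratr_nat sqrtCK.
have ev (p : {poly rat}) : exists a' b' : rat,
    (map_poly ratr p).[z] = ratr a' + ratr b' * s /\
    (map_poly ratr p).[ratr a - ratr b * s] = ratr a' - ratr b' * s.
  elim/poly_ind: p => [|p k [a' [b' [eq1 eq2]]]].
    by exists 0, 0; rewrite !rmorph0 !horner0 mul0r addr0 subr0.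
  exists (a' * a + D * b' * b + k), (a' * b + b' * a).
  have horner_cons x : (map_poly ratr (p * 'X + k%:P)).[x] =
      (map_poly ratr p).[x] * x + ratr k :> algC.
    by rewrite rmorphD rmorphM /= map_polyX map_polyC hornerD hornerM hornerX hornerC.
  rewrite !horner_cons eq1 eq2 /z.
  by rewrite !(rmorphD, rmorphM) /= ratr_D; split; ring.
have [p [def_p _] _] := minCpolyP z.
have [a' [b' [eq1 eq2]]] := ev p.
have root_z : (map_poly ratr p).[z] = 0 by rewrite -def_p; apply/rootP/root_minCpoly.
move: eq1; rewrite root_z => /esym ab0; have b0 := sqrt_irrational _ _ ab0.
rewrite b0 rmorph0 mul0r addr0 in ab0; rewrite b0 ab0 rmorph0 mul0r subrr in eq2.
apply: (@root_monic_Aint (minCpoly z)) => //.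
  by apply/rootP; rewrite def_p.
exact: minCpoly_monic.
Qed.

(** The square of the denominator divides d times the square of the numerator; being coprime to the
    latter, it divides d. *)
Lemma square_free_denominator (b : rat) :
  (d%:R * b ^+ 2 \is a Num.int) -> b \is a Num.int.
Proof.
move=> /intrP[x def_x].
have nz : (denq b)%:~R != 0 :> rat by rewrite intr_eq0 denq_neq0.
have E : d%:Z * numq b ^+ 2 = x * denq b ^+ 2.
  apply: (@intr_inj rat); rewrite !expr2 !intrM -def_x -pmulrn.
  have -> : b ^+ 2 = ((numq b)%:~R / (denq b)%:~R) ^+ 2 by rewrite divq_num_den.
  by field.
have : (denq b ^+ 2 %| d%:Z * numq b ^+ 2)%Z by rewrite E dvdz_mull.
rewrite Gauss_dvdzl; last first.
  by rewrite coprimezXl ?coprimezXr // coprimez_sym coprimezE coprime_num_den.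
rewrite dvdzE abszX /= => /d_sqf den1.
by rewrite Qint_def; apply/eqP; have := denq_gt0 b; lia.
Qed.

(** The trace u = 2 a and the norm k are rational algebraic integers, hence integers. Then d (2 b) ^
    2 = u ^ 2 - 4 k is one too, and so is v = 2 b because d is square-free. *)
Lemma quad_integers_half (z : algC) : quad_integers d z ->
  exists u v k : int, z = (u%:~R + v%:~R * s) / 2 /\ u ^+ 2 - d%:Z * v ^+ 2 = 4 * k.
Proof.
move=> [[a [b ->]] Az]; rewrite -/s in Az *; have Az' := Aint_conj _ _ Az.
have /intrP[u def_u] : 2 * a \is a Num.int.
  apply: Aint_ratr_int; suff -> : ratr (2 * a) =
      (ratr a + ratr b * s) + (ratr a - ratr b * s).
    exact: rpredD.
  by rewrite rmorphM /= ratr_nat; ring.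
have /intrP[k def_k] : a ^+ 2 - d%:R * b ^+ 2 \is a Num.int.
  apply: Aint_ratr_int; suff -> : ratr (a ^+ 2 - d%:R * b ^+ 2) =
      (ratr a + ratr b * s) * (ratr a - ratr b * s) by apply: rpredM.
  by rewrite rmorphB rmorphXn rmorphM rmorphXn /= ratr_nat -(sqrtCK d%:R) -/s; ring.
have /intrP[v def_v] : 2 * b \is a Num.int.
  apply: square_free_denominator.
  suff -> : d%:R * (2 * b) ^+ 2 = (u ^+ 2 - 4 * k)%:~R by apply: intr_int.
  by rewrite rmorphB rmorphXn rmorphM /= -def_u -def_k; ring.
exists u, v, k; split.
  have -> : u%:~R = 2 * ratr a :> algC by rewrite -ratr_int -def_u rmorphM /= ratr_nat.
  have -> : v%:~R = 2 * ratr b :> algC by rewrite -ratr_int -def_v rmorphM /= ratr_nat.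
  by field.
apply: (@intr_inj rat); rewrite rmorphB rmorphXn rmorphM rmorphXn rmorphM /=.
rewrite -def_u -def_v -def_k.
by rewrite -pmulrn; ring.
Qed.

End QuadraticIntegers.

(** * The fields with d = m ^ 2 + 1 *)

Section RichaudDegert.
Local Open Scope ring_scope.
Variable m : nat.
Hypothesis m_gt0 : (0 < m)%N.
Let d := (m ^ 2 + 1)%N.
Hypothesis d_sqf : square_free d.
Let s : algC := sqrtC d%:R.

(** * Odd m, and the field of m = 1 *)

Section OddCase.
Hypothesis m_odd : odd m.

Lemma odd_sqr : s ^+ 2 = 0%:~R * s + d%:Z%:~R.
Proof. by rewrite sqrtCK mul0r add0r. Qed.

Lemma odd_fieldP z : quad_field d z <-> exists a b, z = qel s a b.
Proof. by []. Qed.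

(** Here d is 2 modulo 4, so 4 can divide u ^ 2 - d v ^ 2 only if u and v are both even. *)
Lemma odd_integersP z : quad_integers d z <-> exists x y, z = zel s x y.
Proof.
split=> [/(quad_integers_half m m_gt0 d_sqf) [u [v [k [-> norm_uv]]]] | [x [y ->]]].
  pose j := (m./2)%:Z.
  have def_d : d%:Z = 4 * (j ^+ 2 + j) + 2 by rewrite /d /j; have := odd_double_half m; nia.
  pose u' := (u %/ 2)%Z; pose v' := (v %/ 2)%Z.
  have [eq_u | eq_u] : u = 2 * u' \/ u = 2 * u' + 1 by rewrite /u'; lia.
    have [eq_v | eq_v] : v = 2 * v' \/ v = 2 * v' + 1 by rewrite /v'; lia.
      exists u', v'; rewrite -/d -/s /zel /qel !ratr_int eq_u eq_v !rmorphM /=; by field.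
    by move: norm_uv; rewrite def_d eq_u eq_v; lia.
  by move: norm_uv; rewrite def_d eq_u; lia.
apply: conj; first by exists x%:~R, y%:~R.
rewrite /zel /qel !ratr_int; apply: rpredD; first exact: Aint_int.
by apply: rpredM; [apply: Aint_int | apply: Aint_quadratic odd_sqr].
Qed.

Lemma odd_class_number : class_number d = 1%N -> m = 1%N.
Proof.
move=> /(class_number1P _ _ _ odd_sqr (sqrt_irrational m m_gt0) _
  odd_fieldP odd_integersP) PID.
have := prime_norm_of_principal _ _ _ odd_sqr (sqrt_irrational m m_gt0) _
  odd_fieldP odd_integersP 2 0 isT PID.
have -> : znorm 0 d 0 1 = - d%:Z by rewrite /znorm; ring.
have -> : (2 %| - d%:Z)%Z by rewrite rpredN dvdzE /d /=; lia.
move=> /(_ isT) [x [y norm2]].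
(* For m > 1 the norm 2 is below 2 m and would have to be a square. *)
have [m_gt1 | ] := ltnP 1 m; last by lia.
have norm_eq : znorm 0 d x y = x ^+ 2 - (m%:Z ^+ 2 + 1) * y ^+ 2.
  by rewrite /znorm /d -mulnn PoszD PoszM; ring.
have [] := small_norm_is_square m x y; rewrite -norm_eq norm2; first by lia.
by move=> [|[|k]]; lia.
Qed.

End OddCase.

Lemma class_number_2 : m = 1%N -> class_number d = 1%N.
Proof.
move=> m1; have m_odd : odd m by rewrite m1.
apply/(class_number1P _ _ _ odd_sqr (sqrt_irrational m m_gt0) _
  odd_fieldP (odd_integersP m_odd)).
apply: (fractional_ideal_principal _ _ _ odd_sqr (sqrt_irrational m m_gt0) _
  odd_fieldP (odd_integersP m_odd)).
(* The remainder r of b modulo q works for every prime q: [|r ^ 2 - 2|] < q ^ 2 as soon as 0 <= r <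
   q and q >= 2. *)
move=> q b q_pr _; exists (b %/ q)%Z.
have -> : b - (b %/ q)%Z * q = (b %% q)%Z by rewrite {1}(divz_eq b q); ring.
have q_gt1 := prime_gt1 q_pr; have := modz_ge0 b (_ : q%:Z != 0).
have := ltz_pmod b (_ : 0 < q%:Z); rewrite /znorm /d m1.
by move=> /(_ _) + /(_ _); nia.
Qed.

(** * Even m = 2 n *)

Section EvenCase.
Variable n : nat.
Hypothesis m_even : m = (2 * n)%N.
Let w : algC := (1 + s) / 2.

Lemma even_sqr : w ^+ 2 = 1%:~R * w + (n ^ 2)%N%:Z%:~R.
Proof.
have s2 : s ^+ 2 = 4 * n%:R ^+ 2 + 1.
  by rewrite sqrtCK /d m_even natrD natrX natrM; ring.
have -> : w ^+ 2 = (1 + 2 * s + s ^+ 2) / 4 by rewrite /w; field.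
by rewrite s2 /w -pmulrn natrX; field.
Qed.

Lemma even_qel a b : qel w a b = ratr (a + b / 2) + ratr (b / 2) * s.
Proof.
have half : ratr (b / 2) = ratr b / 2 :> algC by rewrite fmorph_div /= ratr_nat.
by rewrite /qel /w rmorphD half; field.
Qed.

Lemma even_irr a b : ratr a + ratr b * w = 0 -> b = 0.
Proof.
rewrite -/(qel w a b) even_qel => /(sqrt_irrational m m_gt0) /eqP.
by rewrite mulf_eq0 invr_eq0 orbF => /eqP.
Qed.

Lemma even_fieldP z : quad_field d z <-> exists a b, z = qel w a b.
Proof.
split=> [[a [b ->]] | [a [b ->]]].
  exists (a - b), (2 * b); rewrite even_qel.
  by congr (ratr _ + ratr _ * _); field.
by rewrite even_qel; do 2 eexists.
Qed.

(** Here d is 1 modulo 4, so 4 divides u ^ 2 - d v ^ 2 only if u and v have the same parity. *)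
Lemma even_integersP z : quad_integers d z <-> exists x y, z = zel w x y.
Proof.
split=> [/(quad_integers_half m m_gt0 d_sqf) [u [v [k [-> norm_uv]]]] | [x [y ->]]].
  have def_d : d%:Z = 4 * n%:Z ^+ 2 + 1 by rewrite /d m_even; nia.
  pose u' := (u %/ 2)%Z; pose v' := (v %/ 2)%Z.
  have [eq_u | eq_u] : u = v + 2 * (u' - v') \/ exists x y,
      (u = 2 * x + 1 /\ v = 2 * y) \/ (u = 2 * x /\ v = 2 * y + 1).
  - have : u = 2 * u' \/ u = 2 * u' + 1 by rewrite /u'; lia.
    have : v = 2 * v' \/ v = 2 * v' + 1 by rewrite /v'; lia.
    move=> [] Ev [] Eu; [left | right | right | left]; try lia; exists u', v'; lia.
  - exists (u' - v'), v; rewrite -/d -/s /zel /qel !ratr_int eq_u /w.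
    by rewrite !(rmorphD, rmorphB, rmorphM) /=; field.
  by case: eq_u => x [y [[eq_u eq_v] | [eq_u eq_v]]]; move: norm_uv; rewrite def_d eq_u eq_v; lia.
apply: conj; first by apply/even_fieldP; exists x%:~R, y%:~R.
rewrite /zel /qel !ratr_int; apply: rpredD; first exact: Aint_int.
by apply: rpredM; [apply: Aint_int | apply: Aint_quadratic even_sqr].
Qed.

Lemma even_znorm b : znorm 1 (n ^ 2)%N b 1 = b ^+ 2 + b - n%:Z ^+ 2.
Proof. by rewrite /znorm -mulnn PoszM; ring. Qed.

(** Such a q is, up to sign, a norm N(x + y w), and 4 N(x + y w) = (2 x + y) ^ 2 - d y ^ 2. If q <
    n, then 4 q < 2 m, so 4 q would be a square, and q with it. *)
Lemma even_split_prime (q : nat) (b : int) : class_number d = 1%N -> prime q ->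
  (q%:Z %| b ^+ 2 + b - n%:Z ^+ 2)%Z -> (n <= q)%N.
Proof.
move=> /(class_number1P _ _ _ even_sqr even_irr _ even_fieldP even_integersP) PID q_pr.
have := prime_norm_of_principal _ _ _ even_sqr even_irr _
  even_fieldP even_integersP q b q_pr PID.
rewrite even_znorm => H /H [x [y norm_q]].
rewrite leqNgt; apply/negP => lt_qn.
have norm_eq : (2 * x + y) ^+ 2 - (m%:Z ^+ 2 + 1) * y ^+ 2 = 4 * znorm 1 (n ^ 2)%N x y.
  by rewrite /znorm m_even -mulnn !PoszM; ring.
have [] := small_norm_is_square m (2 * x + y) y; rewrite norm_eq normrM norm_q.
  by rewrite m_even; lia.
move=> k eq_k; have eq_k2 : (4 * q = k ^ 2)%N by lia.
have /dvdnP[k' def_k] : (2 %| k)%N.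
  suff : (2 %| k ^ 2)%N by rewrite Euclid_dvdX // andbT.
  by rewrite -eq_k2 dvdn_mulr.
rewrite def_k in eq_k2.
move: eq_k2; rewrite expnMn mulnC => /eqP; rewrite eqn_pmul2r // => /eqP def_q.
by move: q_pr; rewrite def_q => /prime_not_square.
Qed.

Lemma class_number_even : (0 < n)%N ->
  class_number d = 1%N <-> n = 1%N \/
    (prime n /\ forall t : nat, (1 <= t <= n - 1)%N -> prime (n ^ 2 - t * (t + 1))).
Proof.
move=> n_gt0; split=> [h1 | primes].
  have [-> | n_neq1] := eqVneq n 1%N; [by left | right].
  have n_gt1 : (1 < n)%N by lia.
  split.
    have q_pr := pdiv_prime n_gt1.
    (* With b = 0 the norm is - n ^ 2, so the least prime factor of n is at least n. *)
    have := even_split_prime _ 0 h1 q_pr; rewrite expr0n /= !add0r rpredN.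
    rewrite dvdz_exp // ?dvdzE ?pdiv_dvd // => /(_ isT) le_n.
    have : pdiv n = n by apply/eqP; rewrite eqn_leq le_n pdiv_leq.
    by move=> <-.
  move=> t /andP[t_gt0 t_lt]; set P := (_ - _)%N.
  (* As t <= n - 1, the truncated subtraction in P is exact. A composite P < n ^ 2 would have a
     prime factor below n. *)
  have P_lb : (n <= P)%N by rewrite /P; nia.
  have P_ub : (P < n ^ 2)%N by rewrite /P; nia.
  apply/negPn/negP => P_npr.
  have P_gt1 : (1 < P)%N by lia.
  have q_pr := pdiv_prime P_gt1.
  have : (n <= pdiv P)%N.
    apply: (even_split_prime _ t%:Z h1 q_pr).
    have -> : t%:Z ^+ 2 + t%:Z - n%:Z ^+ 2 = - P%:Z by rewrite /P; nia.
    by rewrite rpredN dvdzE pdiv_dvd.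
  have : (pdiv P ^ 2 <= P)%N.
    rewrite leqNgt; apply: contra P_npr; apply: ltn_pdiv2_prime; exact: ltnW.
  by nia.
apply/(class_number1P _ _ _ even_sqr even_irr _ even_fieldP even_integersP).
apply: (fractional_ideal_principal _ _ _ even_sqr even_irr _ even_fieldP even_integersP).
move=> q b q_pr; have q_gt1 := prime_gt1 q_pr.
pose r := (b %% q)%Z; have def_b : b = (b %/ q)%Z * q%:Z + r by apply: divz_eq.
have [r_ge0 r_lt] : 0 <= r /\ r < q%:Z by rewrite modz_ge0 ?ltz_pmod //; lia.
move: (b %/ q)%Z r def_b r_ge0 r_lt => k r -> r_ge0 r_lt; rewrite even_znorm => dvd.
have {dvd} dvd_r : (q%:Z %| r ^+ 2 + r - n%:Z ^+ 2)%Z.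
  have -> : r ^+ 2 + r - n%:Z ^+ 2 = ((k * q%:Z + r) ^+ 2 + (k * q%:Z + r) - n%:Z ^+ 2)
     - k * (k * q%:Z + 2 * r + 1) * q%:Z by ring.
  exact: rpredB dvd (dvdz_mull _ (dvdzz _)).
(* For q > n, both r ^ 2 + r <= q ^ 2 - q and n ^ 2 are below q ^ 2, so r itself serves. *)
have [lt_nq | le_qn] := ltnP n q.
  exists k; rewrite (_ : _ - _ = r) ?even_znorm; [nia | ring].
have [n_pr n_primes] : prime n /\ forall t : nat, (1 <= t <= n - 1)%N ->
    prime (n ^ 2 - t * (t + 1)) by case: primes => // n1; lia.
have [r0 | r_neq0] := eqVneq r 0.
  have /eqP eq_qn : q == n.
    rewrite -dvdn_prime2 // -[(q %| n)%N]andbT -(Euclid_dvdX n 2 q_pr).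
    by move: dvd_r; rewrite r0 expr0n /= !add0r rpredN dvdzE abszX.
  (* The representative - n is taken, since N(- n + w) = - n, whereas N(w) = - n ^ 2 is too
     large. *)
  exists (k + 1); rewrite (_ : _ - _ = - q%:Z) ?even_znorm -?eq_qn; last by rewrite r0; ring.
  by nia.
exists k; rewrite (_ : _ - _ = r) ?even_znorm; last by ring.
(* Now 1 <= r <= q - 1 <= n - 1, so the norm is minus a prime; q divides it, hence equals that
   prime, and q < q ^ 2. *)
have P_pr : prime (n ^ 2 - `|r| * (`|r| + 1)) by apply: n_primes; lia.
have eq_P : r ^+ 2 + r - n%:Z ^+ 2 = - (n ^ 2 - `|r| * (`|r| + 1))%N%:Z by nia.
move: dvd_r; rewrite eq_P rpredN normrN dvdzE /= dvdn_prime2 // => /eqP <-.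
by nia.
Qed.

End EvenCase.
End RichaudDegert.

(* The disjunct m = 2 corrects the source: h(5) = 1, but 2 is not of the form
   2p with p prime. *)
Theorem theorem1p3 (m : nat) (m_gt0 : 0 < m) (m_sqf : square_free (m ^ 2 + 1)) :
  class_number (m ^ 2 + 1) = 1 <->
  m = 1 \/ m = 2 \/
  exists p : nat, prime p /\ m = 2 * p /\
    forall t : nat, 1 <= t <= p - 1 -> prime (p ^ 2 - t * (t + 1)).
Proof.
have [m_odd | m_even] := boolP (odd m).
  split=> [/odd_class_number -> // | [m1 | ]]; [by left | exact: class_number_2 |].
  by case=> [m2 | [p [_ [m2p _]]]]; exfalso; lia.
have m2n : m = 2 * m./2 by have := odd_double_half m; lia.
rewrite (class_number_even m m_gt0 m_sqf _ m2n); last by lia.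
split=> [[n1 | [n_pr n_primes]] | ].
- by right; left; lia.
- by right; right; exists m./2.
case=> [m1 | [m2 | [p [p_pr [m2p p_primes]]]]]; [lia | left; lia | right].
by have -> : m./2 = p by lia.
Qed.
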